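(* Let $m$ denote a positive odd integer. Then: (1) $\mathrm{sat}((2,-1), \mathbb{Z}_m)<\sqrt{c_m\cdot m}$ for some constant $c_m\in [1,3]$ depending only on $m$. (2) If $\frac23(4^n-1) < m<4^n$ holds for some positive integer $n$, then $a((2,-1), \mathbb{Z}_m)<\sqrt{c_m \cdot m}$ for some constant $c_m\in [1, 1.5]$ depending only on $m$. (3) $\sqrt{2m}-0.5<\mathrm{sat}((1/2, 1/2), \mathbb{Z}_m)\leq (\sqrt{3.5}+o(1))\sqrt{m}$, where $o(1)$ refers to $m\to\infty$ through odd integers. (4) If $m=2^{2t}+2^t+1$ for some positive integer $t$, then $a((2,-1), \mathbb{Z}_m)=\lceil\sqrt{m}\,\rceil$.
   Context: $\mathbb{Z}_m$ is the cyclic group of order $m$. For an abelian group $G$ and $w=(w_1,w_2)\in\mathbb{Z}\times\mathbb{Z}$, or $w=(\frac12,\frac12)$ when $G$ has odd order (then $\frac12 g$ is the unique $x\in G$ with $x+x=g$): a set $A\subseteq G$ is $w$-avoiding if there are no pairwise distinct $a,a',a''\in A$ with $a=w_1a'+w_2a''$; it is $w$-saturating if for each $x\in G\setminus A$ there are $a',a''\in A$ with $a'\neq a''$ and $x=w_1a'+w_2a''$; it is complete $w$-avoiding if it is both $w$-avoiding and $w$-saturating. $\mathrm{sat}(w,G)$ is the minimum size of a $w$-saturating set of $G$, and $a(w,G)$ is the minimum size of a complete $w$-avoiding set of $G$ ($\infty$ if none exists). *)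

(* Defs.v *)
From mathcomp Require Import all_boot all_order all_algebra.
From mathcomp Require Import all_classical all_reals all_analysis.

Set Implicit Arguments.
Unset Strict Implicit.
Unset Printing Implicit Defensive.

Import Order.TTheory GRing.Theory Num.Theory.
Local Open Scope ring_scope.

(* ['I_n.+1] carries the additive group of integers modulo [n.+1], so this is
   Z_m for every m >= 1; MathComp's ['Z_m] would be Z_2 for m = 1. *)
Definition cyclicZ (m : nat) : finZmodType := 'I_m.-1.+1.

(* [HalfWeight] stands for w = (1/2, 1/2), meant for groups of odd order. *)
Variant weight := IntWeight of int & int | HalfWeight.

Section WeightedSets.
Variable G : finZmodType.
Implicit Types (w : weight) (A : {set G}).

(* In a group of odd order exactly one x satisfies x + x = g; the default 0 is
   then never used. *)
Definition half (g : G) : G := odflt 0 [pick x : G | x + x == g].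

Definition wcomb w (a b : G) : G :=
  match w with
  | IntWeight w1 w2 => a *~ w1 + b *~ w2
  | HalfWeight => half a + half b
  end.

Definition avoiding w A : bool :=
  ~~ [exists a in A, exists a' in A, exists a'' in A,
        uniq [:: a; a'; a''] && (a == wcomb w a' a'')].

Definition saturating w A : bool :=
  [forall x in ~: A, exists a' in A, exists a'' in A,
     (a' != a'') && (x == wcomb w a' a'')].

Definition complete_avoiding w A : bool := avoiding w A && saturating w A.

End WeightedSets.

Definition sat (R : realType) (w : weight) (G : finZmodType) : \bar R :=
  \big[Order.min/+oo%E]_(A : {set G} | saturating w A) (#|A|%:R)%:E.

Definition min_complete (R : realType) (w : weight) (G : finZmodType) : \bar R :=
  \big[Order.min/+oo%E]_(A : {set G} | complete_avoiding w A) (#|A|%:R)%:E.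

(* Main.v *)
Require Import Defs.
From mathcomp Require Import all_boot all_order all_algebra all_solvable all_field.
From mathcomp Require Import all_classical all_reals all_analysis.
From mathcomp Require Import zify ring lra.

Set Implicit Arguments.
Unset Strict Implicit.
Unset Printing Implicit Defensive.

Import Order.TTheory GRing.Theory Num.Theory.
Import numFieldNormedType.Exports.
Local Open Scope ring_scope.

(* For the weight (2, -1), if [D] is the set of numbers with [n] base-4 digits
   in {0, 1}, each of the [4 ^ n] consecutive integers with digits in
   {-1, 0, 1, 2} is of the form [2 a - b], which gives (2); (1) follows by also
   allowing a leading digit in {0, 1, 2}.  A set is (1/2, 1/2)-saturating in a
   group of odd order iff it is an additive 2-basis, so that (3) combines pair
   counting with Mrose's basis.  For (4), Singer's perfect difference set
   {i | Tr (g ^ i) = 0} modulo [q ^ 2 + q + 1], [q = 2 ^ t], is invariant under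
   doubling, so [2 a - b] runs over its differences; as these represent each
   nonzero element once, [2 b = a + c] forces [a = c]. *)

(** * Upper bounds on the two minima from a single set *)

Lemma le_sat (R : realType) (w : weight) (G : finZmodType) (A : {set G}) (k : nat) :
  saturating w A -> (#|A| <= k)%N -> (sat R w G <= k%:R%:E)%E.
Proof.
move=> satA leAk; apply: (@le_trans _ _ (#|A|%:R)%:E).
  exact: (bigmin_le_cond _ (fun A : {set G} => (#|A|%:R)%:E)).
by rewrite lee_fin ler_nat.
Qed.

Lemma le_min_complete (R : realType) (w : weight) (G : finZmodType)
    (A : {set G}) (k : nat) :
  complete_avoiding w A -> (#|A| <= k)%N ->
  (min_complete R w G <= k%:R%:E)%E.
Proof.
move=> compA leAk; apply: (@le_trans _ _ (#|A|%:R)%:E).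
  exact: (bigmin_le_cond _ (fun A : {set G} => (#|A|%:R)%:E)).
by rewrite lee_fin ler_nat.
Qed.

(** * Base-4 digits and the weight (2, -1) *)

Lemma wcomb_2m1 (G : finZmodType) (x a b : G) :
  (x == wcomb (IntWeight 2 (-1)) a b) = (x + b == a + a).
Proof. by rewrite /= -pmulrn mulr2n mulrNz mulr1z -subr_eq opprK. Qed.

(** Both side conditions come for free: [x] in [A] is covered by [a = b = x], and [a = b] forces
    [x = a], an element of [A]. *)
Lemma saturating_2m1P (G : finZmodType) (A : {set G}) :
  reflect (forall x, exists a b, [/\ a \in A, b \in A & x + b = a + a])
          (saturating (IntWeight 2 (-1)) A).
Proof.
apply: (iffP forall_inP) => [satA x|coverA x].
  have [Ax|nAx] := boolP (x \in A); first by exists x, x.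
  have /satA/exists_inP[a Aa /exists_inP[b Ab /andP[_]]] : x \in ~: A by rewrite inE.
  by rewrite wcomb_2m1 => /eqP xE; exists a, b.
rewrite inE => nAx; have [a [b [Aa Ab xE]]] := coverA x.
apply/exists_inP; exists a => //; apply/exists_inP; exists b => //.
rewrite wcomb_2m1 xE eqxx andbT; apply: contraNneq nAx => abE.
by move: xE; rewrite -abE => /addIr->.
Qed.

Lemma avoiding_2m1 (G : finZmodType) (A : {set G}) :
  (forall a b c, a \in A -> b \in A -> c \in A -> a + c = b + b -> a = c) ->
  avoiding (IntWeight 2 (-1)) A.
Proof.
move=> avA; apply/exists_inP => -[a Aa /exists_inP[b Ab /exists_inP[c Ac]]].
case/andP; rewrite wcomb_2m1 /= !inE => uniq_abc /eqP /(avA _ _ _ Aa Ab Ac) acE.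
by move: uniq_abc; rewrite acE eqxx orbT.
Qed.

Lemma card_saturating_2m1 (G : finZmodType) (A : {set G}) :
  saturating (IntWeight 2 (-1)) A -> (#|G| <= #|A| ^ 2)%N.
Proof.
move=> /saturating_2m1P coverA; rewrite expnS expn1 -cardsX -cardsT.
apply: leq_trans (leq_imset_card (fun p : G * G => p.1 + p.1 - p.2) _).
apply/subset_leq_card/fintype.subsetP => x _; have [a [b [Aa Ab xE]]] := coverA x.
by apply/imsetP; exists (a, b); rewrite ?inE ?Aa //= -xE addrK.
Qed.

Definition residues (n : nat) (s : seq nat) : {set 'I_n.+1} :=
  [set x in [seq inZp a | a <- s]].

Lemma card_residues (n : nat) (s : seq nat) : (#|residues n s| <= size s)%N.
Proof. by rewrite cardsE (leq_trans (card_size _)) ?size_map. Qed.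

Lemma mem_residues (n : nat) (s : seq nat) (a : nat) :
  a \in s -> inZp a \in residues n s.
Proof. by move=> sa; rewrite inE map_f. Qed.

Lemma residuesP (n : nat) (s : seq nat) (x : 'I_n.+1) :
  x \in residues n s -> exists2 a, a \in s & x = inZp a.
Proof. by rewrite inE => /mapP. Qed.

Lemma inZpD (n a b : nat) : inZp (a + b) = inZp a + inZp b :> 'I_n.+1.
Proof. by apply: val_inj; rewrite /= modnDm. Qed.

(* The shift [e] keeps the values of [2 a - b] nonnegative. *)
Definition covers (s : seq nat) (e L : nat) : Prop :=
  forall z, (z < L)%N -> exists a b, [/\ a \in s, b \in s & (z + b = a + a + e)%N].

(** Since [L] is at least the modulus [n.+1], the range covered meets every class; the shift by [e]
    only permutes the classes. *)
Lemma saturating_residues (n e L : nat) (s : seq nat) :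
  covers s e L -> (n < L)%N -> saturating (IntWeight 2 (-1)) (residues n s).
Proof.
move=> covs ltnL; apply/saturating_2m1P => x; set z := x + inZp e.
have [|a [b [sa sb zE]]] := covs z; first exact: leq_trans ltnL.
exists (inZp a), (inZp b); split; rewrite ?mem_residues //.
apply: (addIr (inZp e)); rewrite -!inZpD -zE inZpD valZpK /z addrAC; congr (_ + _).
Qed.

(** Appends a lowest base-4 digit, 0 or 1. *)
Definition spread (s : seq nat) : seq nat :=
  [seq 4 * a | a <- s]%N ++ [seq 4 * a + 1 | a <- s]%N.

Lemma size_spread (k : nat) (s : seq nat) :
  size (iter k spread s) = (2 ^ k * size s)%N.
Proof.
elim: k => [|k IHk] /=; first by rewrite mul1n.
by rewrite size_cat !size_map IHk expnS; lia.
Qed.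

Lemma spreadP (s : seq nat) (a : nat) :
  reflect (exists b d, [/\ b \in s, (d <= 1)%N & a = 4 * b + d]%N) (a \in spread s).
Proof.
rewrite mem_cat; apply: (iffP orP) => [[]/mapP[b sb ->]|[b [d [sb]]]].
- by exists b, 0%N; rewrite addn0.
- by exists b, 1%N.
case: d => [|[|//]] _ ->; [left|right]; last exact: map_f.
by rewrite addn0 map_f.
Qed.

(** New low digits [u] and [v] contribute [2 u - v + 1], which takes each of the values 0, 1, 2, 3
    once and so matches the last base-4 digit of [z] without a carry. *)
Lemma covers_spread (s : seq nat) (e L : nat) :
  covers s e L -> covers (spread s) (4 * e + 1) (4 * L).
Proof.
move=> covs z ltzL; have [|a [b [sa sb zE]]] := covs (z %/ 4)%N; first by lia.
have digit u v : (u <= 1)%N -> (v <= 1)%N -> (z %% 4 + v = u + u + 1)%N ->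
    exists c d, [/\ c \in spread s, d \in spread s
                  & (z + d = c + c + (4 * e + 1))%N].
  move=> u1 v1 uvE; exists (4 * a + u)%N, (4 * b + v)%N.
  split; [by apply/spreadP; exists a, u|by apply/spreadP; exists b, v|lia].
have : (z %% 4 < 4)%N by rewrite ltn_mod.
move rE: (z %% 4)%N digit => r; case: r rE => [|[|[|[|//]]]] _ digit _.
- exact: (digit 0 1)%N.
- exact: (digit 0 0)%N.
- exact: (digit 1 1)%N.
- exact: (digit 1 0)%N.
Qed.

Lemma covers_iter_spread (k : nat) (s : seq nat) (e L : nat) :
  covers s e L -> exists e', covers (iter k spread s) e' (4 ^ k * L).
Proof.
move=> covs; elim: k => [|k [e' IHk]]; first by exists e; rewrite mul1n.
by exists (4 * e' + 1)%N; rewrite expnS -mulnA; apply: covers_spread.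
Qed.

Lemma covers1 : covers [:: 0%N] 0 1.
Proof. by move=> [|//] _; exists 0%N, 0%N. Qed.

(** Three leading digits already reach the seven values from -2 to 4. *)
Lemma covers3 : covers [:: 0; 1; 2]%N 2 7.
Proof.
do 7?[case]; last by [].
- by move=> _; exists 0%N, 2%N.
- by move=> _; exists 0%N, 1%N.
- by move=> _; exists 0%N, 0%N.
- by move=> _; exists 1%N, 1%N.
- by move=> _; exists 1%N, 0%N.
- by move=> _; exists 2%N, 1%N.
- by move=> _; exists 2%N, 0%N.
Qed.

Lemma sat_2m1_cyclic_lt (R : realType) (m : nat) : (0 < m)%N ->
  (sat R (IntWeight 2 (-1)) (cyclicZ m) < (Num.sqrt (3 * m%:R))%:E)%E.
Proof.
case: m => // n _; suff [s [e [L [covs ltnL sz_s]]]] : exists s e L,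
    [/\ covers s e L, (n < L)%N & (size s ^ 2 < 3 * n.+1)%N].
  apply: (@le_lt_trans _ _ (size s)%:R%:E).
    exact: le_sat (saturating_residues covs ltnL) (card_residues _ _).
  rewrite lte_fin -[ltLHS]ger0_norm // -sqrtr_sqr ltr_sqrt.
    by rewrite -natrX -natrM ltr_nat.
  by rewrite mulr_gt0 ?ltr0n.
set k := trunc_log 4 n.+1.
have /andP[le4k lt4k] : (4 ^ k <= n.+1 < 4 ^ k.+1)%N by exact: trunc_log_bounds.
(* All [k.+1]-digit numbers form a set of squared size [4 ^ k.+1], small enough if this is below
   [3 * n.+1]. Otherwise the modulus is at most [16/3 * 4 ^ (k - 1)], and the leading digits 0, 1, 2
   followed by [k - 1] binary ones cover [7 * 4 ^ (k - 1)] integers with squared size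
   [9 * 4 ^ (k - 1) < 3 * 4 ^ k]. For [k = 0] only the modulus 1 remains. *)
have [le3|lt3] := leqP (3 * n.+1) (4 ^ k.+1); last first.
  have [e cov] := covers_iter_spread k.+1 covers1.
  exists (iter k.+1 spread [:: 0%N]), e, (4 ^ k.+1 * 1)%N; split=> //; first by lia.
  by rewrite size_spread muln1 -expnM mulnC expnM.
move: le4k lt4k le3; case: k => [|k] le4k lt4k le3.
  by exists [:: 0%N], 0%N, 1%N; split; [exact: covers1 | lia | rewrite /=; lia].
have [e cov] := covers_iter_spread k covers3.
exists (iter k spread [:: 0; 1; 2]%N), e, (4 ^ k * 7)%N; split=> //.
  by move: le3; rewrite !expnS; lia.
rewrite size_spread /= expnMn -expnM [(k * 2)%N]mulnC expnM.
rewrite -[(2 ^ 2)%N]/4%N -[(3 ^ 2)%N]/9%N.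
by move: le4k; rewrite expnS; lia.
Qed.

Lemma spread_bound (k : nat) (a : nat) :
  a \in iter k spread [:: 0%N] -> (3 * a < 4 ^ k)%N.
Proof.
elim: k a => [|k IHk] a /=; first by rewrite inE => /eqP->.
by case/spreadP => b [d [/IHk ltb d1 ->]]; rewrite expnS; lia.
Qed.

(** Digits 0 and 1 add without carry in base 4, so the equation holds digit by digit, and
    [a0 + c0 = 2 b0] forces [a0 = c0]. *)
Lemma spread_avoiding (k a b c : nat) :
  a \in iter k spread [:: 0%N] -> b \in iter k spread [:: 0%N] ->
  c \in iter k spread [:: 0%N] -> (a + c = b + b)%N -> a = c.
Proof.
elim: k a b c => [|k IHk] a b c /=; first by rewrite !inE => /eqP-> _ /eqP->.
case/spreadP => a1 [a0 [/IHk IHa a01 ->]] /spreadP[b1 [b0 [/IHa IHb b01 ->]]].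
case/spreadP => c1 [c0 [/IHb IHc c01 ->]] abcE.
have -> : a1 = c1 by apply: IHc; lia.
by lia.
Qed.

Lemma min_complete_2m1_cyclic_le (R : realType) (m n : nat) :
  (2 * 4 ^ n < 3 * m + 2)%N -> (m < 4 ^ n)%N ->
  (min_complete R (IntWeight 2 (-1)) (cyclicZ m) <= (2 ^ n)%:R%:E)%E.
Proof.
case: m => [|m] gtm ltm; first by have := expn_gt0 4 n; lia.
set s := iter n spread [:: 0%N].
have sz : (size s <= 2 ^ n)%N by rewrite size_spread muln1.
apply: le_min_complete (leq_trans (card_residues m s) sz).
apply/andP; split; last first.
  have [e cov] := covers_iter_spread n covers1.
  by apply: saturating_residues cov _; lia.
apply: avoiding_2m1 => _ _ _ /residuesP[a sa ->] /residuesP[b sb ->] /residuesP[c sc ->].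
rewrite -!inZpD => /(congr1 val) /=.
move: (spread_bound sa) (spread_bound sb) (spread_bound sc) => la lb lc.
(* Elements are at most [(4 ^ n - 1) / 3], so neither sum wraps around the modulus. *)
rewrite !modn_small; try lia.
by move=> /(spread_avoiding sa sb sc)->.
Qed.

Lemma min_complete_2m1_cyclic_lt (R : realType) (m n : nat) :
  (2 / 3 : R) * (4 ^+ n - 1) < m%:R -> (m < 4 ^ n)%N ->
  (min_complete R (IntWeight 2 (-1)) (cyclicZ m)
     < (Num.sqrt (3 / 2 * m%:R))%:E)%E.
Proof.
move=> gtm ltm; have {}gtm : (2 * 4 ^ n < 3 * m + 2)%N.
  by rewrite -(ltr_nat R) natrD !natrM natrX; move: gtm; lra.
apply: le_lt_trans (min_complete_2m1_cyclic_le R gtm ltm) _.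
(* As [2 * 4 ^ n] is 2 modulo 3, being below [3 * m + 2] already puts it below [3 * m]. *)
have mod3 : (4 ^ n %% 3 = 1)%N by rewrite -modnXm exp1n.
have lt3 : (2 * 4 ^ n < 3 * m)%N by lia.
rewrite lte_fin -[ltLHS]ger0_norm // -sqrtr_sqr ltr_sqrt; last first.
  by rewrite mulr_gt0 ?divr_gt0 // ltr0n; lia.
by move: lt3; rewrite -(ltr_nat R) !natrM -natrX -expnM mulnC expnM; lra.
Qed.

(** * The weight (1/2, 1/2) *)

(** Each element outside [A] is the sum of the halves over some 2-subset of [A]. *)
Lemma card_saturating_half (G : finZmodType) (A : {set G}) :
  saturating HalfWeight A -> (#|G| <= #|A| + 'C(#|A|, 2))%N.
Proof.
move=> /forall_inP satA.
pose f (B : {set G}) := \sum_(b in B) Defs.half b.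
pose P := [set B : {set G} | B \subset A & #|B| == 2%N].
apply: (@leq_trans #|A :|: [set f B | B in P]|).
  rewrite -cardsT; apply/subset_leq_card/fintype.subsetP => x _.
  rewrite inE; have [//|nAx] /= := boolP (x \in A).
  have /satA/exists_inP[a Aa /exists_inP[b Ab /andP[ab /eqP->]]] : x \in ~: A.
    by rewrite inE.
  apply/imsetP; exists [set a; b].
    by rewrite inE cards2 ab finset.subUset !finset.sub1set Aa Ab.
  by rewrite /f big_setU1 ?big_set1 // inE.
rewrite -cards_draws; apply: leq_trans (leq_add (leqnn _) (leq_imset_card f P)).
exact: leq_card_setU.
Qed.

(** For a saturating set of size [k], twice the order of [G] is at most
    [k ^ 2 + k = (k + 1/2) ^ 2 - 1/4]. *)
Lemma sat_half_gt (R : realType) (G : finZmodType) :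
  ((Num.sqrt (2 * #|G|%:R) - 1 / 2)%:E < sat R HalfWeight G)%E.
Proof.
apply: lt_bigmin => [|A /card_saturating_half leG]; first by rewrite ltry.
rewrite lte_fin ltrBlDr -[ltRHS]ger0_norm ?addr_ge0 // -sqrtr_sqr ltr_sqrt; last first.
  by rewrite exprn_gt0 // ltr_wpDl.
have : (2 * #|G| <= #|A| * #|A| + #|A|)%N.
  have := mul_bin_diag #|A| 1; rewrite bin1.
  by case: #|A| leG => //=; lia.
rewrite -(ler_nat R) natrD !natrM => leGA; apply: le_lt_trans leGA _.
rewrite -subr_gt0.
have -> : (#|A|%:R + 1 / 2) ^+ 2 - (#|A|%:R * #|A|%:R + #|A|%:R) = 1 / 4 :> R by field.
by [].
Qed.

Lemma mulrn_order (n : nat) (x : 'I_n.+1) : x *+ n.+1 = 0.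
Proof. by apply: val_inj; rewrite Zp_mulrn /= modnMl. Qed.

Lemma double_inj (n : nat) : odd n.+1 -> injective (fun x : 'I_n.+1 => x + x).
Proof.
(* The multiplier [(n.+2)./2] is the inverse of 2 modulo [n.+1]. *)
move=> odd_n x y /(congr1 (fun z => z *+ (n.+2)./2)); rewrite -!mulr2n -!mulrnA.
have -> : (2 * n.+2./2 = n.+1 + 1)%N by lia.
by rewrite !mulrnDr !mulrn_order !add0r !mulr1n.
Qed.

Lemma half_addK (n : nat) (x : 'I_n.+1) : odd n.+1 -> Defs.half x + Defs.half x = x.
Proof.
move=> odd_n; rewrite /Defs.half; case: pickP => [y /eqP //|/(_ (x *+ (n.+2)./2))].
rewrite -mulr2n -mulrnA; have -> : (n.+2./2 * 2 = n.+1 + 1)%N by lia.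
by rewrite mulrnDr mulrn_order add0r mulr1n eqxx.
Qed.

Lemma saturating_half (n : nat) (A : {set 'I_n.+1}) : odd n.+1 ->
  (forall x, exists a b, [/\ a \in A, b \in A & x = a + b]) ->
  saturating HalfWeight A.
Proof.
move=> odd_n coverA; apply/forall_inP => x; rewrite inE => nAx.
(* Halving [x + x = a + b] gives the required form; [a = b] would give [x = a], in [A]. *)
have [a [b [Aa Ab xE]]] := coverA (x + x).
apply/exists_inP; exists a => //; apply/exists_inP; exists b => //.
apply/andP; split.
  by apply: contraNneq nAx => abE; move: xE; rewrite -abE => /(double_inj odd_n)->.
apply/eqP/(double_inj odd_n); rewrite /= xE.
by rewrite addrACA !half_addK.
Qed.

Definition progression (a d k : nat) : seq nat := [seq (a + d * i)%N | i <- iota 0 k].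

Lemma mem_progression (a d k i : nat) :
  (i < k)%N -> (a + d * i)%N \in progression a d k.
Proof. by move=> ltik; apply: map_f; rewrite mem_iota. Qed.

Lemma size_progression (a d k : nat) : size (progression a d k) = k.
Proof. by rewrite size_map size_iota. Qed.

(* Mrose's additive 2-basis: of size [7 t + 3], with sums up to [14 t^2 + 10 t - 1]. *)
Definition mrose (t : nat) : seq nat :=
  (progression 0 1 t.+1 ++
   progression (2 * t) t (3 * t) ++
   progression (3 * t ^ 2 + 2 * t) t.+1 t ++
   progression (6 * t ^ 2 + 4 * t) 1 t.+1 ++
   progression (10 * t ^ 2 + 7 * t) 1 t.+1)%N.

Lemma size_mrose (t : nat) : size (mrose t) = (7 * t + 3)%N.
Proof. by rewrite !size_cat !size_progression; lia. Qed.

(* The first three progressions make the sums with any run of [t + 1]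
   consecutive integers starting at [c] fill [c, c + 4 t^2 + 3 t). *)
Lemma mrose_shift (t c z : nat) : (0 < t)%N ->
  {subset progression c 1 t.+1 <= mrose t} ->
  (c <= z < c + 4 * t ^ 2 + 3 * t)%N ->
  exists a b, [/\ a \in mrose t, b \in mrose t & z = a + b]%N.
Proof.
move=> t_gt0 sub_c /andP[lecz ltz].
have base i : (i <= t)%N -> (c + i)%N \in mrose t.
  by move=> leit; have /sub_c := @mem_progression c 1 t.+1 i leit; rewrite mul1n.
have [y yE] : exists y, z = (c + y)%N by exists (z - c)%N; lia.
rewrite {z}yE in lecz ltz *; have {lecz}ltz : (y < 4 * t ^ 2 + 3 * t)%N by lia.
have [lt1|ge1] := ltnP y (2 * t).
  have [let_y|gtt_y] := leqP y t.
    exists (c + y)%N, (0 + 1 * 0)%N; split; [exact: base| |lia].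
    by rewrite mem_cat mem_progression.
  exists (c + t)%N, (0 + 1 * (y - t))%N; split; [exact: base| |lia].
  by rewrite mem_cat mem_progression //; lia.
(* In both remaining ranges the quotient by the step of a progression selects its term, and the
   remainder is absorbed by the run at [c]. *)
have [lt2|ge2] := ltnP y (3 * t ^ 2 + 2 * t).
  have [q [r [qE ltrt]]] : exists q r, (y - 2 * t = q * t + r)%N /\ (r < t)%N.
    exists ((y - 2 * t) %/ t)%N, ((y - 2 * t) %% t)%N.
    by rewrite -divn_eq ltn_mod.
  have ltq : (q < 3 * t)%N by rewrite -(ltn_pmul2r t_gt0); lia.
  exists (c + r)%N, (2 * t + t * q)%N; split; [by apply: base; lia| |lia].
  by rewrite !mem_cat mem_progression ?orbT.
have [q [r [qE ltrt]]] : exists q r,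
    (y - (3 * t ^ 2 + 2 * t) = q * t.+1 + r)%N /\ (r < t.+1)%N.
  exists ((y - (3 * t ^ 2 + 2 * t)) %/ t.+1)%N, ((y - (3 * t ^ 2 + 2 * t)) %% t.+1)%N.
  by rewrite -divn_eq ltn_mod.
have ltq : (q < t)%N by nia.
exists (c + r)%N, (3 * t ^ 2 + 2 * t + t.+1 * q)%N; split; [by apply: base; lia| |lia].
by rewrite !mem_cat mem_progression ?orbT.
Qed.

Lemma mroseP (t z : nat) : (0 < t)%N -> (z < 14 * t ^ 2 + 10 * t)%N ->
  exists a b, [/\ a \in mrose t, b \in mrose t & z = a + b]%N.
Proof.
move=> t_gt0 ltz.
have [lt1|ge1] := ltnP z (4 * t ^ 2 + 3 * t).
  by apply: (@mrose_shift t 0) => // x xP; rewrite !mem_cat xP.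
have [lt2|ge2] := ltnP z (6 * t ^ 2 + 4 * t); last first.
  have [lt3|ge3] := ltnP z (10 * t ^ 2 + 7 * t).
    apply: (@mrose_shift t (6 * t ^ 2 + 4 * t)%N) => //; last by lia.
    by move=> x xP; rewrite !mem_cat xP !orbT.
  apply: (@mrose_shift t (10 * t ^ 2 + 7 * t)%N) => //; last by lia.
  by move=> x xP; rewrite !mem_cat xP !orbT.
(* The gap left by the three runs is filled by sums of the second and third progressions: term [r]
   of the third is [r] modulo [t], and the second, of step [t], supplies the rest. *)
have [q [r [qE ltrt]]] : exists q r, (z - 3 * t ^ 2 = q * t + r)%N /\ (r < t)%N.
  exists ((z - 3 * t ^ 2) %/ t)%N, ((z - 3 * t ^ 2) %% t)%N.
  by rewrite -divn_eq ltn_mod.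
have leq : (r + 4 <= q <= 3 * t + 3 + r)%N by nia.
exists (2 * t + t * (q - r - 4))%N, (3 * t ^ 2 + 2 * t + t.+1 * r)%N.
split; [| |nia]; rewrite !mem_cat mem_progression ?orbT //; lia.
Qed.

Lemma sat_half_le (R : realType) (m t : nat) : odd m -> (0 < t)%N ->
  (m <= 14 * t ^ 2)%N -> (sat R HalfWeight (cyclicZ m) <= (7 * t + 3)%:R%:E)%E.
Proof.
case: m => // n odd_n t_gt0 len; rewrite -size_mrose.
apply: le_sat (card_residues n (mrose t)); apply: saturating_half => // x.
have [|a [b [sa sb xE]]] := @mroseP t x t_gt0; first by have := ltn_ord x; lia.
by exists (inZp a), (inZp b); rewrite !mem_residues // -inZpD -xE valZpK.
Qed.

Lemma sat_half_le_sqrt (R : realType) (m : nat) : odd m ->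
  (sat R HalfWeight (cyclicZ m)
     <= ((Num.sqrt (7 / 2) + 10 / Num.sqrt m%:R) * Num.sqrt m%:R)%:E)%E.
Proof.
move=> odd_m; have m_gt0 : (0 < m)%N by case: (m) odd_m.
(* Here [7 * y] equals [sqrt (7/2) * sqrt m], and rounding [y] up to [t] costs at most 1, so
   [7 * t + 3 <= 7 * y + 10]. *)
pose y : R := Num.sqrt (m%:R / 14); pose t := (Num.truncn y).+1.
have y_ge0 : 0 <= y by exact: sqrtr_ge0.
have /andP[le_y lt_y] := truncn_itv y_ge0.
have yE : 14 * y ^+ 2 = m%:R by rewrite sqr_sqrtr ?divr_ge0 //; field.
apply: le_trans (sat_half_le R odd_m (ltn0Sn _ : 0 < t)%N _) _.
  rewrite -(ler_nat R) natrM natrX -yE ler_pM2l // lerXn2r ?nnegrE //; exact: ltW.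
have sqE : Num.sqrt (7 / 2) * Num.sqrt m%:R = 7 * y :> R.
  rewrite -[RHS]ger0_norm ?mulr_ge0 // -sqrtr_sqr exprMn -sqrtrM //.
  by congr Num.sqrt; rewrite -yE; field.
have sqm_neq0 : Num.sqrt m%:R != 0 :> R by rewrite gt_eqF // sqrtr_gt0 ltr0n.
rewrite lee_fin mulrDl divfK // sqE natrD natrM /t -[(_.+1)%:R]natr1.
by move: le_y; lra.
Qed.

Lemma cvg_inv_sqrt_nat (R : realType) :
  ((10 / Num.sqrt n%:R : R) @[n --> \oo] --> (0 : R))%classic.
Proof.
apply/cvgr0Pnorm_lt => e e_gt0; near=> n.
have n_gt : (10 / e) ^+ 2 < n%:R by near: n; exact: nbhs_infty_gtr.
have n_gt0 : 0 < n%:R :> R by apply: le_lt_trans n_gt; exact: sqr_ge0.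
rewrite ger0_norm ?divr_ge0 // ltr_pdivrMr ?sqrtr_gt0 // mulrC -ltr_pdivrMr //.
by rewrite -[ltLHS]ger0_norm ?divr_ge0 1?ltW // -sqrtr_sqr ltr_sqrt.
Unshelve. all: by end_near. Qed.

(** * Perfect difference sets *)

Section PerfectDifferenceSet.
Variables (G : finZmodType) (D : {set G}).
Hypothesis diff_ex : forall x, x != 0 -> exists a b, [/\ a \in D, b \in D & a = x + b].
Hypothesis diff_inj : forall a b c d, a \in D -> b \in D -> c \in D -> d \in D ->
  a != b -> a + d = c + b -> b = d.
Hypothesis doubleD : forall x, (x + x \in D) = (x \in D).
Hypothesis double_surj : forall x : G, exists y, x = y + y.

(** Subtraction maps the off-diagonal pairs injectively to nonzero elements; the diagonal adds
    [#|D|]. *)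
Lemma card_perfect_difference : (#|D| ^ 2 <= #|G|.-1 + #|D|)%N.
Proof.
pose diag := [set (a, a) | a in D].
pose off := finset.setX D D :\: diag.
have offP p : p \in off -> [/\ p.1 \in D, p.2 \in D & p.1 != p.2].
  case: p => a b; rewrite !inE /= => /andP[nab /andP[Da Db]]; split=> //.
  by apply: contra nab => /eqP->; apply: imset_f.
have off_inj : {in off &, injective (fun p => p.1 - p.2)}.
  move=> [a b] [c d] /offP[/= Da Db ab] /offP[/= Dc Dd _] /eqP.
  rewrite subr_eq addrAC eq_sym subr_eq => /eqP E.
  have bd : b = d by apply: (diff_inj Da Db Dc Dd ab).
  by move: E; rewrite bd => /addIr->.
have le_off : (#|off| <= #|G|.-1)%N.
  rewrite -(card_in_imset off_inj) -(cardC1 0).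
  apply/subset_leq_card/fintype.subsetP => _ /imsetP[p /offP[_ _ neq] ->].
  by rewrite !inE subr_eq0.
have le_diag : (#|diag| <= #|D|)%N by exact: leq_imset_card.
rewrite expnS expn1 -cardsX -(cardsID diag) addnC leq_add //.
by apply: leq_trans le_diag; exact/subset_leq_card/finset.subsetIr.
Qed.

Lemma complete_perfect_difference :
  (exists x : G, x != 0) -> complete_avoiding (IntWeight 2 (-1)) D.
Proof.
move=> [x0 x0_neq0]; apply/andP; split.
  (* Here [c] is both [(b + b) - a] and [(c + c) - c], differences of elements of [D], hence [a = c]
     by uniqueness if [c] is nonzero. Otherwise [a] and [c] exchange roles. *)
  have av a b c : a \in D -> b \in D -> c \in D -> c != 0 -> a + c = b + b -> a = c.
    move=> Da Db Dc c_neq0 E; apply: (@diff_inj (b + b) a (c + c) c) => //.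
    - by rewrite doubleD.
    - by rewrite doubleD.
    - by rewrite -E -subr_eq0 addrAC subrr add0r.
    - by rewrite -E -addrA addrC.
  apply: avoiding_2m1 => a b c Da Db Dc E.
  have [c0|c_neq0] := eqVneq c 0; last exact: av E.
  have [a0|a_neq0] := eqVneq a 0; first by rewrite a0 c0.
  by apply/esym/(av c b a) => //; rewrite addrC.
apply/saturating_2m1P => x; have [->|/diff_ex[c [b [Dc Db cE]]]] := eqVneq x 0.
  have [a [_ [Da _ _]]] := diff_ex x0_neq0.
  by exists a, (a + a); rewrite doubleD add0r.
have [a aE] := double_surj c; exists a, b; split => //; last by rewrite -aE.
by rewrite -doubleD -aE.
Qed.

End PerfectDifferenceSet.

(** * Trace kernels for a map of order dividing 3 *)

Section TraceKernel.
Variables (F : fieldType) (phi : F -> F).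
Hypothesis phiB : {morph phi : x y / x - y}.
Hypothesis phiM : {morph phi : x y / x * y}.
Hypothesis phi3 : forall x, phi (phi (phi x)) = x.

(** When [phi] is the [q]-th power map on the field with [q ^ 3] elements, this is the trace to the
    subfield with [q] elements. *)
Definition trace3 (x : F) : F := x + phi x + phi (phi x).

(** First coordinate of the cross product of [(b, phi b, phi^2 b)] and [(1, 1, 1)]; the others are
    its images under [phi] and [phi^2]. *)
Let cross (b : F) : F := phi b - phi (phi b).

Lemma trace3_cross (b : F) : trace3 (cross b) = 0 /\ trace3 (b * cross b) = 0.
Proof.
by rewrite /trace3 /cross !(phiM, phiB, phi3); split; ring.
Qed.

Lemma cross_neq0 (b : F) : phi b != b -> cross b != 0.
Proof.
apply: contra; rewrite /cross subr_eq0 => /eqP /(congr1 (fun x => phi (phi x))).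
by rewrite !phi3 => <-.
Qed.

(* Both [(u, phi u, phi^2 u)] and [(v, phi v, phi^2 v)] are orthogonal to the
   independent vectors [(1, 1, 1)] and [(b, phi b, phi^2 b)], so both are
   proportional to their cross product. *)
Lemma trace3_kernel (b u v : F) : phi b != b ->
  trace3 u = 0 -> trace3 (b * u) = 0 -> trace3 v = 0 -> trace3 (b * v) = 0 ->
  phi u * v = u * phi v.
Proof.
move=> /cross_neq0 w_neq0.
have prop x : trace3 x = 0 -> trace3 (b * x) = 0 ->
    phi x * cross b = x * phi (cross b).
  rewrite /trace3 /cross !(phiM, phiB, phi3) => tx tbx; apply/eqP; rewrite -subr_eq0.
  have -> : phi x * (phi b - phi (phi b)) - x * (phi (phi b) - b)
    = (b * x + phi b * phi x + phi (phi b) * phi (phi x))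
      - phi (phi b) * (x + phi x + phi (phi x)) by ring.
  by rewrite tx tbx mulr0 subrr.
move=> tu tbu tv tbv; apply: (mulIf w_neq0).
rewrite mulrAC (prop u tu tbu) -[RHS]mulrA (prop v tv tbv).
by rewrite -!mulrA; congr (_ * _); rewrite mulrC.
Qed.

End TraceKernel.

Lemma expf_card_pred (F : finFieldType) (x : F) : x != 0 -> x ^+ #|F|.-1 = 1.
Proof.
move=> x_neq0; apply: (mulfI x_neq0).
by rewrite -exprS prednK ?expf_card ?mulr1 // ltnW // finNzRing_gt1.
Qed.

Lemma finField_generator (F : finFieldType) :
  exists g : F, (#|F|.-1).-primitive_root g.
Proof.
have card_gt0 : (0 < #|F|.-1)%N by rewrite -subn1 subn_gt0 finNzRing_gt1.
have : has (#|F|.-1).-primitive_root (enum (predC1 (0 : F))).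
  apply: has_prim_root => //; rewrite ?enum_uniq //; last by rewrite -cardE cardC1.
  apply/allP => x; rewrite mem_enum inE => x_neq0; apply/unity_rootP.
  exact: expf_card_pred.
by case/hasP => g _ gP; exists g.
Qed.

(** * Singer's difference set in characteristic 2 *)

Section Singer.
Variables (t : nat) (F : finFieldType) (g : F).
Let q := (2 ^ t)%N.
Let m := (q ^ 2 + q + 1)%N.
Hypothesis t_gt0 : (0 < t)%N.
Hypothesis charF : 2%N \in [pchar F].
Hypothesis cardF : #|F| = (q ^ 3)%N.
Hypothesis prim_g : (#|F|.-1).-primitive_root g.

Let phi (x : F) : F := x ^+ q.

Let phiD : {morph phi : x y / x + y}.
Proof.
move=> x y; apply: exprDn_pchar.
by rewrite pnatX (eq_pnat _ (pcharf_eq charF)) pnat_id.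
Qed.

Let phiB : {morph phi : x y / x - y}.
Proof. by move=> x y; apply/eqP; rewrite eq_sym subr_eq -phiD subrK. Qed.

Let phiM : {morph phi : x y / x * y}.
Proof. by move=> x y; rewrite /phi exprMn. Qed.

Let phi3 (x : F) : phi (phi (phi x)) = x.
Proof. by rewrite /phi -!exprM -[RHS]expf_card cardF !expnS muln1 mulnA. Qed.

Let order_g : (#|F|.-1 = q.-1 * m)%N.
Proof.
rewrite cardF /m; have : (0 < q)%N by rewrite expn_gt0.
by case: (q) => // r _; nia.
Qed.

Let g_neq0 : g != 0.
Proof.
apply/eqP => g0; have := prim_expr_order prim_g.
have N_gt0 := prim_order_gt0 prim_g.
by rewrite g0 expr0n eqn0Ngt N_gt0 => /esym/eqP; rewrite oner_eq0.
Qed.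

Let E (i : nat) : bool := trace3 phi (g ^+ i) == 0.

(** The order of [g ^+ m] is [q - 1], so it lies in the subfield with [q] elements. Its powers
    therefore factor out of the trace, which makes [E] periodic modulo [m]. *)
Let phi_gm : phi (g ^+ m) = g ^+ m.
Proof.
rewrite /phi -exprM; apply/eqP; rewrite (eq_prim_root_expr prim_g) order_g.
have -> : (m * q = q.-1 * m + m)%N.
  have : (0 < q)%N by rewrite expn_gt0.
  by case: (q) => // r _; lia.
by rewrite modnDl.
Qed.

Let E_mod (i : nat) : E (i %% m)%N = E i.
Proof.
rewrite /E {2}(divn_eq i m) exprD mulnC exprM.
have phiX k : phi ((g ^+ m) ^+ k) = (g ^+ m) ^+ k.
  by rewrite {1}/phi exprAC -/(phi _) phi_gm.
rewrite /trace3 !phiM !phiX -!mulrDr mulf_eq0 expf_eq0 expf_eq0.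
by rewrite (negPf g_neq0) !andbF.
Qed.

(** In characteristic 2, squaring is additive, so the trace of a square is the square of the
    trace. *)
Let E_double (i : nat) : E (i + i) = E i.
Proof.
rewrite /E /trace3 exprD !phiM -!expr2 -!(pFrobenius_autE charF) -!rmorphD.
by rewrite fmorph_eq0.
Qed.

Let phi_gi (i : nat) : (0 < i < m)%N -> phi (g ^+ i) != g ^+ i.
Proof.
move=> /andP[i_gt0 ltim]; rewrite /phi -exprM (eq_prim_root_expr prim_g) order_g.
have q_gt1 : (1 < q)%N by rewrite -[1%N](expn0 2) ltn_exp2l.
rewrite eqn_mod_dvd ?leq_pmulr 1?ltnW //.
have -> : (i * q - i = q.-1 * i)%N by nia.
rewrite dvdn_pmul2l; last by lia.
by apply/negP => /dvdn_leq; lia.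
Qed.

Let E_ex (i : nat) : (0 < i < m)%N -> exists j, E j /\ E (i + j).
Proof.
move=> im; have b_neq := phi_gi im; set b := g ^+ i in b_neq *.
have [tr1 tr2] := trace3_cross phiB phiM phi3 b.
have w_neq0 := cross_neq0 phi3 b_neq.
set w := phi b - _ in tr1 tr2 w_neq0.
have w_unity := expf_card_pred w_neq0.
(* The nonzero [w] is a power of [g], and both [w] and [b * w] have trace zero. *)
have [j wE] := prim_rootP prim_g w_unity; exists j.
by rewrite /E exprD -wE tr1 tr2.
Qed.

(** Proportionality in [trace3_kernel] gives [g ^+ (j * q + k) = g ^+ (j + k * q)], so [(q - 1) m]
    divides [(q - 1) (k - j)]. *)
Let E_inj (i j k : nat) : (0 < i < m)%N ->
  E j -> E (i + j) -> E k -> E (i + k) -> j = k %[mod m].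
Proof.
move=> im /eqP Ej /eqP Eij /eqP Ek /eqP Eik.
rewrite exprD in Eij; rewrite exprD in Eik.
have := trace3_kernel phiB phiM phi3 (phi_gi im) Ej Eij Ek Eik.
rewrite /phi -!exprM -!exprD => /eqP; rewrite (eq_prim_root_expr prim_g) order_g.
have q_gt1 : (1 < q)%N by rewrite -[1%N](expn0 2) ltn_exp2l.
wlog lejk : j k {Ej Eij Ek Eik} / (j <= k)%N.
  move=> hw H; have [lejk|/ltnW lekj] := leqP j k; first exact: hw.
  by apply/esym/hw; rewrite // [(k * q + j)%N]addnC eq_sym [(k + _)%N]addnC.
rewrite eq_sym eqn_mod_dvd; last by nia.
have -> : (j + k * q - (j * q + k) = q.-1 * (k - j))%N by nia.
rewrite dvdn_pmul2l; last by lia.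
by rewrite -eqn_mod_dvd // => /eqP.
Qed.

Lemma singer_set : exists D : {set cyclicZ m},
  complete_avoiding (IntWeight 2 (-1)) D /\ (#|D| <= q + 1)%N.
Proof.
have mS : m.-1.+1 = m by rewrite /m addn1.
pose D := [set x : 'I_m.-1.+1 | E x].
have E_inZp k : (inZp k \in D) = E k by rewrite inE /= mS E_mod.
have DP (x : 'I_m.-1.+1) : (x \in D) = E x by rewrite inE.
have small (x : 'I_m.-1.+1) : (x %% m)%N = x.
  by rewrite modn_small // -[X in (_ < X)%N]mS ltn_ord.
have ltm (x : 'I_m.-1.+1) : x != 0 -> (0 < x < m)%N.
  by move=> x_neq0; rewrite lt0n x_neq0 -[X in (_ < X)%N]mS ltn_ord.
have diff_ex x : x != 0 -> exists a b, [/\ a \in D, b \in D & a = x + b].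
  move=> /ltm/E_ex[j [Ej Exj]]; exists (inZp (x + j)), (inZp j).
  by rewrite !E_inZp inZpD valZpK.
have diff_inj a b c d : a \in D -> b \in D -> c \in D -> d \in D ->
    a != b -> a + d = c + b -> b = d.
  move=> Da Db Dc Dd; rewrite -subr_eq0 => /ltm/E_inj H ad.
  have Eadd y z : y \in D -> z \in D -> y = a - b + z -> E ((a - b)%R + z).
    by move=> Dy Dz yE; rewrite -E_inZp inZpD !valZpK -yE.
  apply: val_inj; have := H b d; rewrite !small; apply; rewrite -?DP //.
    by apply: Eadd Da Db _; rewrite subrK.
  by apply: Eadd Dc Dd _; rewrite addrAC ad addrK.
have doubleD x : (x + x \in D) = (x \in D).
  by rewrite -[x in LHS]valZpK -inZpD E_inZp E_double DP.
(* As [q] is even, [m] is odd, so every element has a half. *)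
have odd_m : odd m.-1.+1.
  by rewrite mS /m oddD oddD oddX /q oddX /=; case: (t) t_gt0.
exists D; split.
  apply: complete_perfect_difference => // [x|].
    by exists (Defs.half x); rewrite half_addK.
  exists (inZp 1); apply/eqP => /(congr1 val) /=; rewrite modn_small //.
  by rewrite mS /m; have := expn_gt0 2 t; rewrite -/q; lia.
(* The bound [k ^ 2 <= q ^ 2 + q + k] forces [k <= q + 1]. *)
have := card_perfect_difference diff_inj; rewrite card_ord /=; move: #|D| => k.
by rewrite /m addn1 /=; nia.
Qed.

End Singer.

Lemma min_complete_singer (R : realType) (t : nat) (m := (2 ^ (2 * t) + 2 ^ t + 1)%N) :
  (0 < t)%N -> min_complete R (IntWeight 2 (-1)) (cyclicZ m) = (2 ^ t + 1)%:R%:E.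
Proof.
move=> t_gt0; have mE : m = ((2 ^ t) ^ 2 + 2 ^ t + 1)%N by rewrite -expnM mulnC.
apply/le_anti/andP; split.
  have t3_gt0 : (0 < t * 3)%N by lia.
  have [F charF cardF] := pPrimePowerField (isT : prime 2) t3_gt0.
  rewrite expnM in cardF; have [g prim_g] := finField_generator F.
  have [D [compD leD]] := singer_set t_gt0 charF cardF prim_g.
  by rewrite mE; apply: le_min_complete compD leD.
(* Pair counting gives [(2 ^ t) ^ 2 < m <= k ^ 2], hence [k >= 2 ^ t + 1]. *)
apply/bigmin_geP; split=> [|A /andP[_ /card_saturating_2m1]]; first by rewrite leey.
rewrite card_ord lee_fin ler_nat; move: #|A| => k; rewrite mE addn1 /=.
by have := expn_gt0 2 t; nia.
Qed.

Lemma ceil_sqrt_singer (R : realType) (q : nat) : (0 < q)%N ->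
  Num.ceil (Num.sqrt ((q ^ 2 + q + 1)%:R : R)) = (q + 1)%:Z.
Proof.
move=> q_gt0; apply: ceil_def; have -> : (q + 1)%:Z - 1 = q%:Z by rewrite PoszD addrK.
rewrite -!pmulrn -[X in X < _]ger0_norm // -[X in _ <= X]ger0_norm // -!sqrtr_sqr.
rewrite ltr_sqrt ?ltr0n ?addn1 // ler_wsqrtr -?natrX ?ler_nat ?ltr_nat ?andbT; lia.
Qed.

Local Open Scope classical_set_scope.

Theorem theorem1p12 (R : realType) :
  [/\ (exists c : nat -> R, forall m : nat, odd m ->
         1 <= c m <= 3 /\
           (sat R (IntWeight 2 (-1)) (cyclicZ m)
              < (Num.sqrt (c m * m%:R))%:E)%E),
      (exists c : nat -> R, forall m n : nat, odd m -> (0 < n)%N ->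
         (2 / 3 : R) * (4 ^+ n - 1) < m%:R -> (m < 4 ^ n)%N ->
         1 <= c m <= 3 / 2 /\
           (min_complete R (IntWeight 2 (-1)) (cyclicZ m)
              < (Num.sqrt (c m * m%:R))%:E)%E),
      (exists o : nat -> R,
         o m @[m --> within [set m | odd m] \oo] --> (0 : R) /\
         forall m : nat, odd m ->
           ((Num.sqrt (2 * m%:R) - 1 / 2)%:E
              < sat R HalfWeight (cyclicZ m)
              <= ((Num.sqrt (7 / 2) + o m) * Num.sqrt m%:R)%:E)%E)
    & (forall m t : nat, odd m -> (0 < t)%N ->
         m = (2 ^ (2 * t) + 2 ^ t + 1)%N ->
         min_complete R (IntWeight 2 (-1)) (cyclicZ m)
           = ((Num.ceil (Num.sqrt (m%:R : R)))%:~R)%:E)].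

Proof.
split.
- exists (fun=> 3) => m odd_m; split; first by apply/andP; split; lra.
  by apply: sat_2m1_cyclic_lt; case: m odd_m.
- exists (fun=> 3 / 2) => m n _ _ gtm ltm.
  by split; [apply/andP; split; lra | exact: min_complete_2m1_cyclic_lt ltm].
- exists (fun m => 10 / Num.sqrt m%:R); split.
    by apply: cvg_within_filter; exact: cvg_inv_sqrt_nat.
  move=> m odd_m; apply/andP; split; last exact: sat_half_le_sqrt.
  have := sat_half_gt R (cyclicZ m).
  by rewrite card_ord prednK //; case: m odd_m.
- move=> m t _ t_gt0 ->; rewrite min_complete_singer //.
  by rewrite mulnC expnM ceil_sqrt_singer ?expn_gt0 // -pmulrn.
Qed.
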